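(* Let $\Gamma$ be a finite connected graph and let $G\leqslant\mathrm{Aut}(\Gamma)$ be such that $\Gamma$ is locally $(G,2)$-arc-transitive and $G$ has exactly two orbits on the vertex set of $\Gamma$, with $G$ quasiprimitive of type PA on both orbits. Then $G$ is not primitive on either orbit.
   Context: An $s$-arc in a graph $\Gamma$ is an $(s+1)$-tuple $(\alpha_0,\dots,\alpha_s)$ of vertices with $\alpha_i$ adjacent to $\alpha_{i+1}$ and $\alpha_i\neq\alpha_{i+2}$ for each $i$. For $G\leqslant\mathrm{Aut}(\Gamma)$, the graph $\Gamma$ is locally $(G,s)$-arc-transitive if for each vertex $\alpha$ the stabiliser $G_\alpha$ acts transitively on the set of all $s$-arcs starting at $\alpha$. A permutation group is quasiprimitive on a set $\Omega$ if it acts faithfully on $\Omega$ and every nontrivial normal subgroup is transitive on $\Omega$. Type PA: a group $G$ acting quasiprimitively on $\Omega$ has type PA if there is a $G$-invariant partition $\mathcal{B}$ of $\Omega$ such that $G$ acts faithfully on $\mathcal{B}$ and $\mathcal{B}$ can be identified with $\Delta^k$ for some set $\Delta$ and some $k\geqslant 2$ in such a way that $G\leqslant H\,\mathrm{wr}\,S_k$ acts in the usual product action of the wreath product on $\Delta^k$, where $H\leqslant\mathrm{Sym}(\Delta)$ is an almost simple group acting quasiprimitively on $\Delta$; moreover, if $T=\mathrm{soc}(H)$, then $G$ has a unique minimal normal subgroup $N=T^k$. The types of quasiprimitive groups are mutually exclusive, and groups whose unique minimal normal subgroup $T^k$ ($k\geqslant2$, $T$ nonabelian simple) is regular have type TW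 (twisted wreath), so for type PA one has $N_\alpha\neq 1$ for $\alpha\in\Omega$. *)

(* Defs.v *)
From mathcomp Require Import all_boot all_fingroup all_solvable.

Set Implicit Arguments.
Unset Strict Implicit.
Unset Printing Implicit Defensive.

Local Open Scope group_scope.

Section Graphs.

Variables (V : finType) (e : rel V).

Definition graph_aut : {set {perm V}} :=
  [set g : {perm V} | [forall x, forall y, e (g x) (g y) == e x y]].

Definition is_arc (s : nat) (p : s.+1.-tuple V) : Prop :=
  (forall i j : 'I_s.+1, j = i.+1 :> nat -> e (tnth p i) (tnth p j)) /\
  (forall i j : 'I_s.+1, j = i.+2 :> nat -> tnth p i != tnth p j).

(* Vacuously true at a vertex with no s-arc; [transitive _, on _ | _] would
   require the set of s-arcs to be nonempty. *)
Definition locally_arc_transitive (G : {set {perm V}}) (s : nat) : Prop :=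
  forall (x : V) (p q : s.+1.-tuple V),
    is_arc p -> is_arc q -> thead p = x -> thead q = x ->
  exists2 g : {perm V}, g \in 'C_G[x | 'P] & map_tuple g p = q.

End Graphs.

Section AbstractGroups.

Variable gT : finGroupType.

(* [minnormal] does not include containment in the ambient group. *)
Definition min_normal_sub (N G : {group gT}) : bool :=
  minnormal N G && (N \subset G).

Definition soc (G : {group gT}) : {group gT} :=
  <<\bigcup_(N : {group gT} | min_normal_sub N G) N>>%G.

(* Inn(T) <= K <= Aut(T) with T nonabelian simple and K isomorphic to G. *)
Definition almost_simple (G : {group gT}) : Prop :=
  exists (sT : finGroupType) (T : {group sT}) (K : {group {perm sT}}),
    [/\ simple T, ~~ abelian T,
        conj_aut T @* T \subset K, K \subset Aut T & G \isog K].

End AbstractGroups.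

Section ProductAction.

Variables (D : finType) (k : nat).

Definition base_fun (h : {ffun 'I_k -> {perm D}}) (f : {ffun 'I_k -> D}) :
  {ffun 'I_k -> D} := [ffun i => h i (f i)].

Lemma base_fun_inj h : injective (base_fun h).
Proof.
move=> f1 f2 /ffunP eqf; apply/ffunP=> i.
by have := eqf i; rewrite !ffunE => /perm_inj.
Qed.

Definition base_perm h : {perm {ffun 'I_k -> D}} := perm (@base_fun_inj h).

(* The inverse makes this a right action, as composition in {perm _} applies
   its left factor first. *)
Definition top_fun (s : 'S_k) (f : {ffun 'I_k -> D}) : {ffun 'I_k -> D} :=
  [ffun i => f (s^-1 i)].

Lemma top_fun_inj s : injective (top_fun s).
Proof.
move=> f1 f2 /ffunP eqf; apply/ffunP=> i.
by have := eqf (s i); rewrite !ffunE permK.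
Qed.

Definition top_perm s : {perm {ffun 'I_k -> D}} := perm (@top_fun_inj s).

Definition base_power (H : {set {perm D}}) : {set {perm {ffun 'I_k -> D}}} :=
  [set base_perm h | h in [set h : {ffun 'I_k -> {perm D}} |
                             [forall i, h i \in H]]].

(* The permutation group induced by H wr S_k in its product action on D^k. *)
Definition product_wreath (H : {set {perm D}}) :
  {set {perm {ffun 'I_k -> D}}} :=
  base_power H * [set top_perm s | s : 'S_k].

Lemma base_permM h1 h2 :
  base_perm h1 * base_perm h2 = base_perm [ffun i => h1 i * h2 i].
Proof.
by apply/permP=> f; apply/ffunP=> i; rewrite !permE /= !permE !ffunE permM.
Qed.

Lemma top_permM s t : top_perm s * top_perm t = top_perm (s * t).
Proof.
by apply/permP=> f; apply/ffunP=> i; rewrite !permE /= !permE !ffunE invMg permM.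
Qed.

Lemma top_base_perm s h :
  top_perm s * base_perm h = base_perm [ffun i => h (s i)] * top_perm s.
Proof.
by apply/permP=> f; apply/ffunP=> i;
  rewrite !permE /= !permE !ffunE permKV.
Qed.

Lemma product_wreath_group_set (H : {group {perm D}}) :
  group_set (product_wreath H).
Proof.
have inB (h : {ffun 'I_k -> {perm D}}) : (forall i, h i \in H) -> base_perm h \in base_power H.
  by move=> Hh; apply: imset_f; rewrite inE; apply/forallP.
apply/group_setP; split.
  apply/mulsgP; exists (base_perm [ffun=> 1]) (top_perm 1); last 1 first.
  - by apply/permP=> f; apply/ffunP=> i;
    rewrite !permE /= !permE !ffunE invg1 !perm1.
  - by apply: inB => i; rewrite ffunE.
  - exact: imset_f.
move=> x y /mulsgP[_ _ /imsetP[h1 + ->] /imsetP[s1 _ ->] ->].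
rewrite inE => /forallP Hh1.
move=> /mulsgP[_ _ /imsetP[h2 + ->] /imsetP[s2 _ ->] ->].
rewrite inE => /forallP Hh2.
rewrite mulgA -(mulgA (base_perm h1)) top_base_perm mulgA base_permM -mulgA.
rewrite top_permM; apply: mem_mulg; last exact: imset_f.
by apply: inB => i; rewrite !ffunE groupM.
Qed.

Canonical product_wreath_group (H : {group {perm D}}) :=
  Group (product_wreath_group_set H).

End ProductAction.

Section Quasiprimitive.

Variables (aT : finGroupType) (rT : finType) (to : {action aT &-> rT}).

Definition quasiprimitive (G : {group aT}) (S : {set rT}) : Prop :=
  [faithful G, on S | to] /\
  (forall N : {group aT}, N <| G -> N :!=: 1 -> [transitive N, on S | to]).

End Quasiprimitive.

Section ProductActionType.

Variables (aT : finGroupType) (rT : finType) (to : {action aT &-> rT}).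

(* B is identified with D^k through phi, and G with a subgroup of H wr S_k
   through rho.  The last clause separates PA from the twisted wreath type TW,
   in which the unique minimal normal subgroup is regular. *)
Definition quasiprimitive_PA (G : {group aT}) (S : {set rT}) : Prop :=
  quasiprimitive to G S /\
  exists (B : {set {set rT}}) (D : finType) (k : nat) (H : {group {perm D}})
         (N : {group aT}) (phi : {set rT} -> {ffun 'I_k -> D})
         (rho : {morphism G >-> {perm {ffun 'I_k -> D}}}),
    [/\ [/\ partition B S, [acts G, on B | to^*] & [faithful G, on B | to^*]],
        [/\ (1 < k)%N, {in B &, injective phi} & phi @: B = [set: _]],
        {in G & B, forall g X, phi (to^*%act X g) = rho g (phi X)}
          /\ rho @* G \subset product_wreath k H,
        [/\ min_normal_sub N G,
            forall M : {group aT}, min_normal_sub M G -> M = N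
          & rho @* N = base_power k (soc H)]
      & forall x, x \in S -> 'C_N[x | to] != 1]
    /\ (almost_simple H /\ quasiprimitive 'P H [set: D]).

End ProductActionType.

(* Main.v *)
Require Import Defs.
From mathcomp Require Import all_boot all_fingroup all_solvable.

(** Both orbits share the unique minimal normal subgroup N = T_1 x ... x T_k of
    G, whose factors are the minimal normal subgroups of N.  Let G be primitive
    on the orbit of x and let y be a neighbour of x in the other orbit.  Then
    N_x is the product of the R_i = N_x :&: T_i.  By 2-arc-transitivity G_xy is
    transitive on the neighbours of x other than y, so each of them lies in
    some R_i-orbit of y.  Hence N_x is the union of R_i N_xy and C N_xy, where
    C is the centraliser of T_i in N_x; a group is not the union of two proper
    subgroups, and G_x permutes the R_i transitively, so N_x = C N_xy.
    As N = <N_x, N_y> by connectivity, N_y projects onto every T_i.  But the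
    product action structure on the orbit of y confines N_y to a product of
    proper subgroups of the T_i. *)

Set Implicit Arguments.
Unset Strict Implicit.
Unset Printing Implicit Defensive.

Local Open Scope group_scope.

(** * Minimal normal subgroups and socles *)

Lemma simple_nonabelian_center (gT : finGroupType) (T : {group gT}) :
  simple T -> ~~ abelian T -> 'Z(T) = 1.
Proof.
case/simpleP=> _ simT nabT; case: (simT _ (center_normal T)) => // ZT.
by case/negP: nabT; rewrite -ZT center_abelian.
Qed.

Lemma min_normal_simple (gT : finGroupType) (T N : {group gT}) :
  simple T -> T <| N -> min_normal_sub T N.
Proof.
case/simpleP=> ntT simT /andP[sTN nTN]; rewrite /min_normal_sub sTN andbT.
apply/mingroupP; split=> [|M /andP[ntM nMN] sMT]; first by rewrite ntT.
case: (simT M); last by [].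
  by rewrite /normal sMT (subset_trans sTN).
by move=> M1; rewrite M1 eqxx in ntM.
Qed.

Lemma min_normal_normal (gT : finGroupType) (T N : {group gT}) :
  min_normal_sub T N -> T <| N.
Proof. by case/andP=> /mingroupp/andP[_ nTN] sTN; apply/andP. Qed.

Lemma min_normal_ntriv (gT : finGroupType) (T N : {group gT}) :
  min_normal_sub T N -> T :!=: 1.
Proof. by case/andP=> /mingroupp/andP[]. Qed.

Lemma min_normal_eq (gT : finGroupType) (T M N : {group gT}) :
  min_normal_sub T N -> M <| N -> M :!=: 1 -> M \subset T -> M :=: T.
Proof.
case/andP=> /mingroupP[_ minT] _ /andP[_ nMN] ntM; apply: minT.
by rewrite ntM.
Qed.

(** The commutator lies in [M :&: T], which is normal in [N]; by minimality this intersection is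
    trivial or equal to both subgroups. *)
Lemma min_normal_commute (gT : finGroupType) (T M N : {group gT}) :
  min_normal_sub T N -> min_normal_sub M N -> M :!=: T -> M \subset 'C(T).
Proof.
move=> mnT mnM neqMT.
have [nsT nsM] := (min_normal_normal mnT, min_normal_normal mnM).
have [sTN nTN] := andP nsT; have [sMN nMN] := andP nsM.
have [TI | ntMT] := eqVneq (M :&: T) 1.
  apply/commG1P/trivgP; rewrite -TI subsetI commg_subl commg_subr.
  by rewrite (subset_trans sMN nTN) (subset_trans sTN nMN).
have nsMT : M :&: T <| N by exact: normalI.
have eqT := min_normal_eq mnT nsMT ntMT (subsetIr _ _).
have eqM := min_normal_eq mnM nsMT ntMT (subsetIl _ _).
by case/eqP: neqMT; rewrite -eqT -eqM.
Qed.

(** Any other minimal normal subgroup of [K] commutes with [I], so it lies in the trivial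
    centraliser. *)
Lemma soc_simple_cent1 (gT : finGroupType) (I K : {group gT}) :
  simple I -> I <| K -> 'C_K(I) = 1 -> soc K :=: I.
Proof.
move=> simI nsI cI1; have mnI := min_normal_simple simI nsI.
rewrite /soc /=; suffices ->: \bigcup_(N : {group gT} | min_normal_sub N K) N = I :> {set gT}.
  exact: genGid.
apply/eqP; rewrite eqEsubset; apply/andP; split; last exact: (bigcup_sup I).
apply/bigcupsP=> M mnM; have [-> //|neqMI] := eqVneq (M :> {set _}) I.
have := min_normal_ntriv mnM; rewrite -subG1 -cI1 subsetI.
by rewrite (normal_sub (min_normal_normal mnM)) (min_normal_commute mnI mnM).
Qed.

Lemma conj_autJ (gT : finGroupType) (T : {group gT}) (a : {perm gT}) (t : gT) :
  a \in Aut T -> t \in T -> conj_aut T t ^ a = conj_aut T (a t).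
Proof.
move=> AutTa Tt; have Tat : a t \in T by rewrite Aut_closed.
apply: (@eq_Aut _ T) => [||y Ty]; rewrite ?groupJ ?Aut_aut //.
have Tz : a^-1 y \in T by rewrite Aut_closed ?groupV.
rewrite conjgE !permM !conj_autE // -[in RHS](permKV a y).
by rewrite -!(autmE AutTa) morphJ.
Qed.

(** If [a] commutes with conjugation by [t], then [t] and [a t] induce the same inner automorphism,
    so they differ by a central element. *)
Lemma cent_inner_Aut (gT : finGroupType) (T : {group gT}) :
  'Z(T) = 1 -> 'C_(Aut T)(conj_aut T @* T) = 1.
Proof.
move=> ZT1; apply/trivgP/subsetP=> a /setIP[AutTa /centP cTa].
rewrite inE; apply/eqP/(eq_Aut AutTa (group1 _)) => t Tt; rewrite perm1.
have nT x : x \in T -> x \in 'N(T) by apply/subsetP; apply: normG.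
have Tat : a t \in T by rewrite Aut_closed.
have : conj_aut T t = conj_aut T (a t).
  by rewrite -conj_autJ //; apply/esym/conjg_fixP/commgP/esym/cTa/mem_morphim/Tt/nT.
move=> eq_c; apply/esym/eqP; rewrite eq_mulgV1 -in_set1 -[[set 1]]ZT1.
rewrite inE groupM ?groupV //= -ker_conj_aut.
rewrite mem_morphpre ?groupM ?groupV ?nT //=.
by rewrite inE morphM ?morphV ?groupV ?nT //= eq_c mulgV.
Qed.

(** Inside [K] the inner automorphisms form a simple normal subgroup with trivial centraliser, hence
    the socle; the isomorphism carries this to [H]. *)
Lemma almost_simple_soc (gT : finGroupType) (H : {group gT}) :
  almost_simple H -> [/\ simple (soc H), ~~ abelian (soc H) & soc H <| H].
Proof.
case=> sT [T [K [simT nabT sIK sKA isoHK]]].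
have ZT1 := simple_nonabelian_center simT nabT.
have nsTN := normG T; set I := conj_aut T @* T in sIK.
have injT : 'injm (restrm nsTN (conj_aut T)).
  by rewrite ker_restrm ker_conj_aut; apply/trivgP.
have isoTI : T \isog I.
  by apply/isogP; exists [morphism of restrm nsTN (conj_aut T)];
    rewrite //= morphim_restrm setIid.
have nsIK : I <| K.
  rewrite /normal sIK; apply: subset_trans sKA _.
  apply/subsetP=> a AutTa; rewrite inE; apply/subsetP=> _ /imsetP[_ /morphimP[t _ Tt ->] ->].
  have Tat : a t \in T by rewrite Aut_closed.
  by rewrite conj_autJ // mem_morphim //= (subsetP nsTN).
have cI1 : 'C_K(I) = 1.
  by apply/trivgP; rewrite -(cent_inner_Aut ZT1) setSI.
case/isogP: (isog_symr isoHK) => f injf fK.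
have {H isoHK fK} <- : (f @* K)%G = H by apply: val_inj.
have socE : soc (f @* K)%G :=: f @* I.
  apply: soc_simple_cent1.
  - by rewrite -(isog_simple (sub_isog sIK injf)) -(isog_simple isoTI).
  - exact: morphim_normal.
  - by rewrite -injm_subcent // cI1 morphim1.
rewrite socE morphim_normal // injm_abelian // -(isog_abelian isoTI).
rewrite -(isog_simple (sub_isog sIK injf)) -(isog_simple isoTI).
by split.
Qed.

Lemma min_normalJ (gT : finGroupType) (T N : {group gT}) g :
  g \in 'N(N) -> min_normal_sub T N -> min_normal_sub (T :^ g)%G N.
Proof.
move=> nNg mnT; have [sTN nTN] := andP (min_normal_normal mnT).
have sTgN : T :^ g \subset N by rewrite sub_conjg (normP _) ?groupV.
rewrite /min_normal_sub sTgN andbT; apply/mingroupP; split=> [|M].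
  rewrite /= trivg_card1 cardJg -trivg_card1 (min_normal_ntriv mnT) /=.
  by rewrite -{1}(normP nNg) normJ conjSg.
case/andP=> ntM nMN sMT; apply/eqP; rewrite -(inj_eq (@conjsg_inj _ g^-1)) conjsgK.
apply/eqP/(min_normal_eq (M := (M :^ g^-1)%G) mnT); last by rewrite sub_conjgV.
  rewrite /normal /= sub_conjgV (normP nNg) (subset_trans sMT) //=.
  have nNg' : g^-1 \in 'N(N) by rewrite groupV.
  by rewrite -{1}(normP nNg') normJ conjSg.
by rewrite /= trivg_card1 cardJg -trivg_card1.
Qed.

(** The conjugates of [T1] generate a normal subgroup of [G], which is [N] by minimality. Were [T2]
    none of them, it would centralise them all and be central in [N]. *)
Lemma min_normal_conj_trans (gT : finGroupType) (G N T1 T2 : {group gT}) :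
  min_normal_sub N G -> 'Z(N) = 1 ->
  min_normal_sub T1 N -> min_normal_sub T2 N ->
  exists2 g, g \in G & T2 :=: T1 :^ g.
Proof.
move=> mnN ZN1 mnT1 mnT2; have [sNG nNG] := andP (min_normal_normal mnN).
have [sT1N _] := andP (min_normal_normal mnT1).
have [sT2N _] := andP (min_normal_normal mnT2).
have [/exists_inP[g Gg /eqP] | /exists_inPn neq] :=
  boolP [exists g in G, (T2 :==: T1 :^ g)]; first by exists g.
have sCN : class_support T1 G \subset N by exact: class_support_sub_norm.
have /= eqN : <<class_support T1 G>> = N.
  apply: (min_normal_eq (M := <<_>>%G) mnN) => /=.
  - rewrite /normal gen_subG (subset_trans sCN) //=.
    by rewrite norms_gen ?class_support_norm.
  - have := min_normal_ntriv mnT1; apply: contraNneq => C1.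
    by rewrite -subG1 -C1 sub_gen // sub_class_support.
  - by rewrite gen_subG.
case/negP: (min_normal_ntriv mnT2); rewrite -subG1 -ZN1 subsetI sT2N.
rewrite -eqN cent_gen centsC class_supportEr; apply/bigcupsP=> g Gg.
rewrite centsC; apply: (min_normal_commute (T := (T1 :^ g)%G) _ mnT2 (neq g Gg)).
exact: min_normalJ (subsetP nNG g Gg) mnT1.
Qed.

Lemma subsetU_group (gT : finGroupType) (X A B : {group gT}) :
  X \subset A :|: B -> X \subset A \/ X \subset B.
Proof.
move=> sX; have [|/subsetPn[x Xx nAx]] := boolP (X \subset A); first by left.
have [|/subsetPn[y Xy nBy]] := boolP (X \subset B); first by right.
have memX z : z \in X -> (z \in A) || (z \in B) by move/(subsetP sX); rewrite inE.
have := memX x Xx; rewrite (negbTE nAx) /= => Bx.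
have := memX y Xy; rewrite (negbTE nBy) orbF => Ay.
by case/orP: (memX _ (groupM Xx Xy)); rewrite ?(groupMr _ Ay) ?(groupMl _ Bx) ?(negbTE nAx) ?(negbTE nBy).
Qed.

(** * Type PA in terms of components *)

Section BasePower.

Variables (D : finType) (k : nat).
Implicit Types (h : {ffun 'I_k -> {perm D}}) (i : 'I_k).

Lemma base_permE h f i : base_perm h f i = h i (f i).
Proof. by rewrite permE ffunE. Qed.

Lemma base_perm_inj : injective (@base_perm D k).
Proof.
move=> h1 h2 eqh; apply/ffunP=> i; apply/permP=> d.
by have /permP/(_ [ffun=> d])/ffunP/(_ i) := eqh; rewrite !base_permE ffunE.
Qed.

Definition coord_perm i (x : {perm D}) : {perm {ffun 'I_k -> D}} :=
  base_perm [ffun j => if j == i then x else 1].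

Lemma coord_permM i : {in [set: {perm D}] &, {morph coord_perm i : x y / x * y}}.
Proof.
move=> x y _ _; rewrite /coord_perm base_permM; congr base_perm.
by apply/ffunP=> j; rewrite !ffunE; case: eqP; rewrite ?mulg1.
Qed.

Canonical coord_morphism i := Morphism (@coord_permM i).

Lemma injm_coord i : 'injm (coord_morphism i).
Proof.
apply/injmP=> x y _ _ /base_perm_inj/ffunP/(_ i).
by rewrite !ffunE eqxx.
Qed.

(** Conjugation by a base element acts on the [i]-th factor through its [i]-th coordinate; this form
    avoids computing the inverse of [base_perm h]. *)
Lemma base_perm_coord_comm h i (x : {perm D}) :
  base_perm h * coord_perm i (x ^ h i) = coord_perm i x * base_perm h.
Proof.
rewrite /coord_perm !base_permM; congr base_perm; apply/ffunP=> j; rewrite !ffunE.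
by case: eqP => [->|_]; rewrite ?mulg1 ?mul1g // -conjgC.
Qed.

Lemma base_perm_prod h (L : {group {perm {ffun 'I_k -> D}}}) :
  (forall i, coord_perm i (h i) \in L) -> base_perm h \in L.
Proof.
(* The coordinates are multiplied in one at a time: [trunc m] keeps those of index below [m]. *)
move=> Lh; pose trunc m := [ffun i : 'I_k => if i < m then h i else 1].
have -> : h = trunc k by apply/ffunP=> i; rewrite ffunE ltn_ord.
suffices trunc_in m : base_perm (trunc m) \in L by [].
elim: m => [|m IHm].
  rewrite (_ : base_perm _ = 1) ?group1 //.
  by apply/permP=> f; apply/ffunP=> i; rewrite base_permE ffunE !perm1.
have [lt_mk | le_km] := ltnP m k; last first.
  rewrite (_ : trunc m.+1 = trunc m) //; apply/ffunP=> i; rewrite !ffunE.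
  by rewrite (leq_trans (ltn_ord i) le_km) (leq_trans (ltn_ord i)) // leqW.
rewrite (_ : trunc m.+1 = [ffun i => trunc m i *
   [ffun j => if j == Ordinal lt_mk then h (Ordinal lt_mk) else 1] i]).
  by rewrite -base_permM groupM //; apply: Lh.
apply/ffunP=> i; rewrite !ffunE ltnS leq_eqVlt -(inj_eq val_inj) /=.
have [eq_im | _] /= := eqVneq (i : nat) m; last by rewrite mulg1.
rewrite eq_im ltnn mul1g; congr (h _); exact: val_inj.
Qed.

Lemma mem_base_power (E : {set {perm D}}) h :
  (base_perm h \in base_power k E) = [forall i, h i \in E].
Proof.
apply/imsetP/idP=> [[h' + /base_perm_inj->] | Eh]; first by rewrite inE.
by exists h; rewrite ?inE.
Qed.

Lemma coord_in_base_power (E : {group {perm D}}) i x :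
  x \in E -> coord_perm i x \in base_power k E.
Proof.
move=> Ex; rewrite mem_base_power; apply/forallP=> j.
by rewrite ffunE; case: ifP.
Qed.

End BasePower.

Arguments coord_morphism {D k} i.
Arguments injm_coord {D k} i.

(** * The direct factors of the base group, pulled back to [N] *)

Section Components.

Variables (D : finType) (k : nat) (E : {group {perm D}}).
Hypotheses (simE : simple E) (nabE : ~~ abelian E).

Variables (aT : finGroupType) (G N : {group aT}).
Variable rho : {morphism G >-> {perm {ffun 'I_k -> D}}}.
Hypotheses (inj_rho : 'injm rho) (sNG : N \subset G).
Hypothesis rhoN : rho @* N = base_power k E.

Lemma rho_base n : n \in N ->
  exists2 h : {ffun 'I_k -> {perm D}}, forall i, h i \in E & rho n = base_perm h.
Proof.
move=> Nn; have: rho n \in rho @* N by rewrite mem_morphim // (subsetP sNG).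
by rewrite rhoN => /imsetP[h]; rewrite inE => /forallP Eh ->; exists h.
Qed.

Lemma lift_base_power p : p \in base_power k E -> exists2 n, n \in N & rho n = p.
Proof. by rewrite -rhoN => /morphimP[n _ Nn ->]; exists n. Qed.

(** The preimage is taken in all of [G]; [inj_rho] and [rhoN] place it inside [N]. *)
Definition component i : {group aT} := (rho @*^-1 (coord_morphism i @* E))%G.

Lemma mem_component i n :
  reflect (n \in N /\ exists2 x, x \in E & rho n = coord_perm i x)
          (n \in component i).
Proof.
apply: (iffP idP) => [/morphpreP[Gn /morphimP[x _ Ex rho_n]] | [Nn [x Ex rho_n]]].
  split; last by exists x.
  have [m Nm rho_m] := lift_base_power (coord_in_base_power i Ex).
  have /(injmP inj_rho) <- // : rho m = rho n by rewrite rho_m.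
  exact: (subsetP sNG).
by apply/morphpreP; split; rewrite ?(subsetP sNG) // rho_n mem_morphim ?inE.
Qed.

Lemma component_normal i : component i <| N.
Proof.
apply/andP; split; first by apply/subsetP=> n /mem_component[].
apply/subsetP=> n Nn; rewrite inE; apply/subsetP=> _ /imsetP[m + ->].
case/mem_component=> Nm [x Ex rho_m]; apply/mem_component.
split; first exact: groupJ.
have [h Eh rho_n] := rho_base Nn; exists (x ^ h i); first exact: groupJ.
rewrite morphJ ?(subsetP sNG) // rho_m rho_n conjgE.
by rewrite -base_perm_coord_comm mulKg.
Qed.

Lemma coord_sub_rho i : coord_morphism i @* E \subset rho @* G.
Proof.
apply: subset_trans (morphimS rho sNG); rewrite rhoN.
by apply/subsetP=> _ /morphimP[x _ Ex ->]; apply: coord_in_base_power.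
Qed.

Lemma component_isog i : E \isog component i.
Proof.
have eqC : rho @* component i = coord_morphism i @* E.
  exact: morphpreK (coord_sub_rho i).
apply: isog_trans (sub_isog (subsetT E) (injm_coord i)) _.
have isoC: component i \isog rho @* component i by rewrite sub_isog ?subsetIl.
by rewrite eqC in isoC; rewrite isog_sym.
Qed.

Lemma component_min_normal i : min_normal_sub (component i) N.
Proof.
by apply: min_normal_simple (component_normal i); rewrite -(isog_simple (component_isog i)).
Qed.

Lemma component_inj i j : component i = component j -> i = j.
Proof.
move=> eq_ij; apply/eqP; apply: contraTT simE => neq_ij.
suffices ->: E :=: 1 by apply/simpleP=> [[]]; rewrite eqxx.
apply/trivgP/subsetP=> x Ex; rewrite inE.
have [n Nn rho_n] := lift_base_power (coord_in_base_power i Ex).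
have: n \in component i by apply/mem_component; split=> //; exists x.
rewrite eq_ij => /mem_component[_ [y _]]; rewrite rho_n.
by move/base_perm_inj/ffunP/(_ i); rewrite !ffunE eqxx (negbTE neq_ij) => ->.
Qed.

(** The [i]-th coordinate commutes with all of [E], so it lies in the trivial centre of [E]. *)
Lemma cent_component i n h : n \in 'C_N(component i) -> rho n = base_perm h -> 
  h i = 1.
Proof.
case/setIP=> Nn /centP cn rho_n.
have [h' Eh rho_n'] := rho_base Nn.
have {}Eh : h i \in E.
  by rewrite (base_perm_inj (etrans (esym rho_n) rho_n')).
apply/set1P; rewrite -[[set 1]](simple_nonabelian_center simE nabE) inE Eh /=.
apply/centP=> x Ex.
have [m Nm rho_m] := lift_base_power (coord_in_base_power i Ex).
have Tm: m \in component i by apply/mem_component; split=> //; exists x.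
have := congr1 rho (cn _ Tm); rewrite !morphM ?(subsetP sNG) // rho_n rho_m.
by rewrite !base_permM => /base_perm_inj/ffunP/(_ i); rewrite !ffunE eqxx.
Qed.

Lemma base_center : 'Z(N) = 1.
Proof.
apply/trivgP/subsetP=> n ZNn; rewrite inE; have [Nn cNn] := setIP ZNn.
have [h Eh rho_n] := rho_base Nn.
apply/eqP/(injmP inj_rho); rewrite ?(subsetP sNG) ?group1 //.
rewrite morph1 rho_n; apply/permP=> f; apply/ffunP=> i; rewrite base_permE.
rewrite (@cent_component i n) ?perm1 //.
by apply/setIP; split=> //; apply: subsetP cNn; rewrite centS ?normal_sub ?component_normal.
Qed.

End Components.

(** * Invariant partitions and primitivity *)

Section Blocks.

Variables (aT : finGroupType) (rT : finType) (to : {action aT &-> rT}).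

Lemma stab_pblock (G : {group aT}) (S : {set rT}) (B : {set {set rT}}) x g :
  partition B S -> [acts G, on B | to^*] -> x \in S ->
  g \in 'C_G[x | to] -> to^*%act (pblock B x) g = pblock B x.
Proof.
case/and3P=> /eqP covB tiB _ actB Sx /setIP[Gg /astab1P fix_x].
have Bx : x \in cover B by rewrite covB.
have BX : to^*%act (pblock B x) g \in B.
  by rewrite (acts_act actB) // pblock_mem.
apply/esym/def_pblock => //; apply/imsetP; exists x; first by rewrite mem_pblock.
by rewrite fix_x.
Qed.

(** Primitivity allows only one block or at least as many blocks as points. A nontrivial group
    acting faithfully on the blocks excludes the first, and the second forces singletons. *)
Lemma primitive_faithful_blocks (G : {group aT}) (S : {set rT})
    (B : {set {set rT}}) x :
  G :!=: 1 -> [primitive G, on S | to] -> partition B S ->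
  [acts G, on B | to^*] -> [faithful G, on B | to^*] -> x \in S ->
  pblock B x = [set x].
Proof.
move=> ntG /andP[_ /existsPn/(_ B)]; rewrite /imprimitivity_system.
move=> + partB actB faithB Sx; rewrite partB actB /=.
have [/eqP covB tiB nB0] := and3P partB.
have Bx : x \in cover B by rewrite covB.
have -> /= : 1 < #|B|.
  rewrite ltnNge; apply: contra ntG => leB1; rewrite -subG1; apply: subset_trans faithB.
  apply/subsetP=> g Gg; apply/setIP; split=> //; apply/astabP=> X BX.
  apply: (card_le1_eqP leB1) => //.
  by rewrite (acts_act actB).
rewrite -leqNgt => leSB; apply/esym/eqP.
rewrite eqEcard sub1set mem_pblock Bx cards1 leqNgt; apply: contraTN leSB => gt1X.
rewrite -ltnNge (card_partition partB) -sum1_card.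
rewrite !(bigD1 (pblock B x) (pblock_mem Bx)) /=.
rewrite -addSn; apply: leq_add => //; apply: leq_sum => X /andP[BX _].
by rewrite card_gt0; apply: contraNneq nB0 => <-.
Qed.

End Blocks.

(* The components of [N] being its minimal normal subgroups, these are the
   only consequences of type PA that the graph-theoretic argument uses. *)
Lemma PA_components (aT : finGroupType) (rT : finType) (to : {action aT &-> rT})
    (G : {group aT}) (S : {set rT}) :
  quasiprimitive_PA to G S ->
  exists N : {group aT},
    [/\ min_normal_sub N G,
        forall M : {group aT}, min_normal_sub M G -> M = N,
        'Z(N) = 1
      & exists T1 T2 : {group aT},
          [/\ min_normal_sub T1 N, min_normal_sub T2 N & T1 <> T2]] /\
    [/\ [transitive N, on S | to],
        forall x, x \in S -> 'C_N[x | to] != 1,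
        exists2 T : {group aT}, min_normal_sub T N &
          forall x, x \in S -> ~~ (N \subset 'C_N(T) * 'C_N[x | to])
      & [primitive G, on S | to] -> forall x, x \in S ->
          'C_N[x | to] \subset
            <<\bigcup_(T : {group aT} | min_normal_sub T N) 'C_T[x | to]>>].
Proof.
case=> [[_ qpG]] [B [D [k [H [N [phi [rho]]]]]]].
case=> [[[partB actB faithB] [k_gt1 inj_phi phiB] [rho_act _]]].
move=> [mnN uniqN rhoN] stabN [asH qpH].
have [simE nabE nsEH] := almost_simple_soc asH.
have [[/eqP covB tiB nB0] nsNG] := (and3P partB, min_normal_normal mnN).
have ntN := min_normal_ntriv mnN; have sNG := normal_sub nsNG.
have ntE : soc H :!=: 1 by case/simpleP: simE.
have inj_rho : 'injm rho.
  apply/subsetP=> g /morphpreP[Gg /set1P rho_g]; apply: (subsetP faithB).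
  apply/setIP; split=> //; apply/astabP=> X BX.
  apply: inj_phi => //; first by rewrite (acts_act actB).
  by rewrite rho_act // rho_g perm1.
have mn_comp := component_min_normal simE inj_rho sNG rhoN.
have fix_block x n : x \in S -> n \in 'C_N[x | to] ->
    rho n (phi (pblock B x)) = phi (pblock B x).
  move=> Sx /setIP[Nn fix_x]; have Gn := subsetP sNG n Nn.
  rewrite -rho_act ?pblock_mem ?covB //; congr phi.
  by apply: stab_pblock partB actB Sx _; apply/setIP.
exists N; split; split=> //.
- exact: (base_center simE nabE inj_rho sNG rhoN).
- pose i1 : 'I_k := Ordinal (ltnW k_gt1); pose i2 : 'I_k := Ordinal k_gt1.
  exists (component (soc H) rho i1), (component (soc H) rho i2); split=> //.
  by move/(component_inj simE inj_rho sNG rhoN).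
- exact: qpG.
(* If N were the product of C_N(T) and N_x, the socle of [H] would fix the [i]-th coordinate [d] of
   the block of [x]: C_N(T) is trivial at [i], and N_x fixes the block. Being transitive on [D], the
   socle would then be trivial. *)
- pose i : 'I_k := Ordinal (ltnW k_gt1); exists (component (soc H) rho i) => // x Sx.
  apply/negP=> /subsetP sN; pose d := phi (pblock B x) i.
  have fix_d e : e \in soc H -> e d = d.
    move=> Ee; have [n Nn rho_n] := lift_base_power rhoN (coord_in_base_power i Ee).
    have /mulsgP[c m Cc Cm def_n] := sN n Nn.
    have [[Nc _] [Nm _]] := (setIP Cc, setIP Cm).
    have [h Eh rho_c] := rho_base sNG rhoN Nc.
    have [h' Eh' rho_m] := rho_base sNG rhoN Nm.
    have hi := cent_component simE nabE inj_rho sNG rhoN Cc rho_c.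
    have h'i : h' i d = d.
      by rewrite /d -base_permE -rho_m fix_block.
    have := rho_n; rewrite def_n morphM ?(subsetP sNG) // rho_c rho_m base_permM.
    by move/base_perm_inj/ffunP/(_ i); rewrite !ffunE eqxx hi mul1g => <-.
  have trE : [transitive soc H, on [set: D] | 'P].
    by case: qpH => _ /(_ _ nsEH ntE).
  have allD d' : d' = d.
    have: d' \in orbit 'P (soc H) d by rewrite (atransP trE) ?inE.
    by case/orbitP=> e Ee <-; apply: fix_d.
  case/negP: ntE; rewrite -subG1; apply/subsetP=> e _; rewrite inE; apply/eqP/permP=> d'.
  by rewrite (allD (e d')) perm1 (allD d').
(* The block of [x] is now [[set x]], so N_x is the stabiliser of a point of D^k. Replacing all
   coordinates but one of an element of N_x by 1 therefore leaves it in N_x. *)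
move=> primG x Sx; have ntG : G :!=: 1.
  by apply: contraNneq ntN => G1; rewrite -subG1 -G1.
have blockx := primitive_faithful_blocks ntG primG partB actB faithB Sx.
set L := <<_>>; apply/subsetP=> n Cn; have [Nn fix_x] := setIP Cn.
have [h Eh rho_n] := rho_base sNG rhoN Nn.
have LG : L \subset G.
  rewrite gen_subG; apply/bigcupsP=> T mnT; apply: subset_trans sNG.
  exact: subset_trans (subsetIl _ _) (normal_sub (min_normal_normal mnT)).
have : rho n \in rho @* L.
  rewrite rho_n; apply: base_perm_prod => i.
  have [m Nm rho_m] := lift_base_power rhoN (coord_in_base_power i (Eh i)).
  have Tm : m \in component (soc H) rho i.
    by apply/(mem_component inj_rho sNG rhoN); split=> //; exists (h i).
  have Gm := subsetP sNG m Nm; rewrite -rho_m mem_morphim // mem_gen //.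
  apply/bigcupP; exists (component (soc H) rho i) => //.
  apply/setIP; split=> //; apply/astab1P/set1P.
  have BX : pblock B x \in B by rewrite pblock_mem ?covB.
  suffices <- : to^*%act (pblock B x) m = [set x].
    by rewrite blockx; apply: imset_f; rewrite inE.
  rewrite -blockx; apply: inj_phi => //; first by rewrite (acts_act actB).
  rewrite rho_act // rho_m; apply/ffunP=> j; rewrite base_permE ffunE.
  case: eqP => [->|_]; last by rewrite perm1.
  by rewrite -base_permE -rho_n fix_block.
case/morphimP=> m Gm Lm /(injmP inj_rho)-> //; exact: (subsetP sNG).
Qed.

(** * The local action on neighbours *)

Section LocalAction.

Variables (V : finType) (e : rel V) (G N : {group {perm V}}).
Hypotheses (e_sym : symmetric e) (G_aut : G \subset graph_aut e).
Hypothesis G_2arc : locally_arc_transitive e G 2.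
Hypothesis nsNG : N <| G.

Lemma stabP (A : {set {perm V}}) x g :
  reflect (g \in A /\ g x = x) (g \in 'C_A[x | 'P]).
Proof. by apply: (iffP setIP) => [[Ag /astab1P] | [Ag gx]]; split=> //; apply/astab1P. Qed.

Lemma graph_autE g x y : g \in G -> e (g x) (g y) = e x y.
Proof.
by move/(subsetP G_aut); rewrite inE => /forallP/(_ x)/forallP/(_ y)/eqP.
Qed.

Lemma two_arc_trans x y z y' z' :
  e x y -> e y z -> x != z -> e x y' -> e y' z' -> x != z' ->
  exists g, [/\ g \in G, g x = x, g y = y' & g z = z'].
Proof.
move=> xy yz xz xy' yz' xz'.
have arc u v w : e u v -> e v w -> u != w -> is_arc e [tuple u; v; w].
  move=> uv vw uw; split=> [] [[|[|[|i]]] //= lti] [[|[|[|j]]] //= ltj] //.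
have [g] := G_2arc (arc x y z xy yz xz) (arc x y' z' xy' yz' xz') erefl erefl.
case/stabP=> Gg gx /(congr1 val)[_ gy gz].
by exists g.
Qed.

(** The 2-arcs [(y, x, n y)] and [(y, x, z)] start at the same vertex [y]; an element carrying the
    first to the second conjugates [n] as wanted. *)
Lemma conj_moves x y z n : n \in G -> n x = x -> n y != y -> e x y -> e x z ->
  z != y -> exists g, [/\ g \in G, g x = x & (n ^ g) y = z].
Proof.
move=> Gn nx ny xy xz zy.
have xny : e x (n y) by rewrite -[x]nx graph_autE.
have [g [Gg gy gx gz]] : exists g, [/\ g \in G, g y = y, g x = x & g (n y) = z].
  by apply: two_arc_trans; rewrite ?(e_sym y) // eq_sym.
exists g; split=> //.
by rewrite conjgE !permM -{1}gy permK gz.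
Qed.

(** Conjugates of [n] by elements fixing [x] stay in N_x and take [y] to every other neighbour, so
    N_x is transitive on the neighbours of [x] once it moves one. *)
Lemma stab_trans x y z z' n : n \in 'C_N[x | 'P] -> n y != y ->
  e x y -> e x z -> e x z' -> exists2 m, m \in 'C_N[x | 'P] & m z = z'.
Proof.
have [sNG nNG] := andP nsNG.
case/stabP=> Nn nx ny xy.
have trans_y u : e x u -> exists2 m, m \in 'C_N[x | 'P] & m y = u.
  have [-> _ | uy xu] := eqVneq u y; first by exists 1; rewrite ?group1 ?perm1.
  have [g [Gg gx ngy]] := conj_moves (subsetP sNG n Nn) nx ny xy xu uy.
  exists (n ^ g) => //; apply/stabP; rewrite memJ_norm ?(subsetP nNG) //.
  by rewrite conjgE !permM -{1}gx permK nx gx.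
move=> /trans_y[m1 Cm1 <-] /trans_y[m2 Cm2 <-].
by exists (m1^-1 * m2); rewrite ?groupM ?groupV // permM permK.
Qed.

Lemma stab_conj g x n : g \in G -> n \in 'C_N[x | 'P] ->
  n ^ g \in 'C_N[g x | 'P].
Proof.
move=> Gg /stabP[Nn nx]; apply/stabP.
by rewrite memJ_norm ?(subsetP (normal_norm nsNG)) // conjgE !permM permK nx.
Qed.

(** * The local action when N_x is generated by its intersections with the components *)

Section Edge.

Variables x y : V.
Hypotheses (xy : e x y) (N_moves : ~~ ('C_N[x | 'P] \subset 'C[y | 'P])).
Hypotheses (mnN : min_normal_sub N G) (ZN1 : 'Z(N) = 1).
Hypothesis N_trans : [transitive N, on orbit 'P G x | 'P].
Hypothesis stab_gen : 'C_N[x | 'P] \subset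
  <<\bigcup_(T : {group {perm V}} | min_normal_sub T N) 'C_T[x | 'P]>>.

(** Some generator of N_x lying in a component moves [y]. Its conjugates given by 2-arc-transitivity
    reach the other neighbours, with conjugate components. *)
Lemma component_orbit_nbr z : e x z ->
  exists T : {group {perm V}},
    min_normal_sub T N /\ exists2 r, r \in 'C_T[x | 'P] & r y = z.
Proof.
have [sNG nNG] := andP nsNG.
have [T mnT [r Tr ry]] : exists2 T : {group {perm V}}, min_normal_sub T N &
    exists2 r, r \in 'C_T[x | 'P] & r y != y.
  have [/existsP[T /andP[mnT /exists_inP[r Tr ry]]] | /existsPn no] :=
    boolP [exists T : {group {perm V}}, min_normal_sub T N &&
             [exists r in 'C_T[x | 'P], r y != y]].
    by exists T => //; exists r.
  case/negP: N_moves; apply: subset_trans stab_gen _; rewrite gen_subG.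
  apply/bigcupsP=> T mnT; apply/subsetP=> r Tr; apply/astab1P.
  have := no T; rewrite mnT /= => /exists_inPn/(_ r Tr).
  by rewrite negbK => /eqP.
move=> xz; have [-> | zy] := eqVneq z y.
  by exists T; split=> //; exists 1; rewrite ?group1 ?perm1.
have [Tr' rx] := stabP _ _ _ Tr.
have Gr : r \in G.
  by rewrite (subsetP sNG) // (subsetP (normal_sub (min_normal_normal mnT))).
have [g [Gg gx rgy]] := conj_moves Gr rx ry xy xz zy.
exists (T :^ g)%G; split; first exact: min_normalJ (subsetP nNG g Gg) mnT.
exists (r ^ g) => //; apply/stabP; rewrite memJ_conjg; split=> //.
by rewrite conjgE !permM -{1}gx permK rx.
Qed.

Lemma stab_sub_cent_prod (T T' : {group {perm V}}) :
  min_normal_sub T N -> min_normal_sub T' N -> T' :!=: T ->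
  'C_N[x | 'P] \subset 'C_N(T) * 'C_N[y | 'P].
Proof.
move=> mnT mnT' neqT; have [sNG nNG] := andP nsNG.
have [nsT nsT'] := (min_normal_normal mnT, min_normal_normal mnT').
have [sTN nTN] := andP nsT; have [sT'N nT'N] := andP nsT'.
set X := 'C_N[x | 'P].
have sXN : X \subset N by exact: subsetIl.
have nbrX n : n \in X -> e x (n y).
  by case/stabP=> Nn nx; rewrite -[x]nx graph_autE // (subsetP sNG).
have facX n r (A : {group {perm V}}) : n \in X -> r \in A -> A \subset X -> r y = n y ->
    n \in 'C_X[y | 'P] * A.
  move=> Xn Ar sAX ry; rewrite -(mulgKV r n) mem_mulg //; apply/stabP.
  rewrite groupM ?groupV ?(subsetP sAX r) //.
  by rewrite permM -ry permK.
(* Once some [c] centralising [T] agrees with [n] at [y], the quotient [n * c^-1] fixes [y]. *)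
suffices trC n : n \in X -> exists2 c, c \in 'C_X(T) & c y = n y.
  apply/subsetP=> n Xn; have [c Cc cy] := trC n Xn.
  have: n \in 'C_X[y | 'P] * 'C_X(T).
    by apply: facX cy => //; apply: subsetIl.
  rewrite (normC (A := 'C_X[y | 'P]) (B := 'C_X(T))).
    by apply: (subsetP (mulgSS _ _)); rewrite setSI.
  apply: subset_trans (subsetIl _ _) _; apply: normsI (normG _) _.
  by rewrite norms_cent // (subset_trans sXN).
pose R := T :&: X; have sRX : R \subset X := subsetIr _ _.
have nRX : X \subset 'N(R) := normsI (subset_trans sXN nTN) (normG X).
have sMJ (A : {group {perm V}}) : 'C_X[y | 'P] * A \subset 'C_X[y | 'P] <*> A.
  by rewrite mulG_subG joing_subl joing_subr.
have sXU : X \subset ('C_X[y | 'P] <*> R) :|: ('C_X[y | 'P] <*> 'C_X(T)).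
  apply/subsetP=> n1 Xn1.
  have [T1 [mnT1 [r T1r ry]]] := component_orbit_nbr (nbrX n1 Xn1).
  have [T1r' rx] := stabP _ _ _ T1r.
  have Xr : r \in X.
    by apply/stabP; rewrite (subsetP (normal_sub (min_normal_normal mnT1))).
  rewrite inE; have [eqT1 | neqT1] := eqVneq (T1 : {set _}) T.
    apply/orP; left; apply: (subsetP (sMJ _)).
    by apply: facX ry; rewrite // inE -eqT1 T1r'.
  apply/orP; right; apply: (subsetP (sMJ _)).
  apply: facX ry; rewrite ?subsetIl // inE Xr.
  by rewrite (subsetP (min_normal_commute mnT mnT1 neqT1)).
have orbC : forall A : {group {perm V}}, X \subset 'N(A) -> X \subset 'C_X[y | 'P] <*> A ->
   forall m, m \in X -> exists2 c, c \in A & c y = m y.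
  move=> A nAX sX n1 /(subsetP sX); rewrite norm_joinEl; last first.
    exact: subset_trans (subsetIl _ _) nAX.
  by case/mulsgP=> m c /stabP[_ my] Ac ->; exists c; rewrite // permM my.
have nCX : X \subset 'N('C_X(T)).
  by rewrite normsI ?normG // (subset_trans sXN) // norms_cent.
(* If [X] is generated by [R] and the stabiliser of [y], then [R] is transitive on the neighbours of
   [x]. So is a conjugate of [R] lying in [T'], and that one centralises [T]. *)
move=> Xn; case: (subsetU_group sXU) => sX; last exact: orbC sX n Xn.
have [g Gg eqT'] := min_normal_conj_trans mnN ZN1 mnT mnT'.
have orbgx : g x \in orbit 'P G x by apply/orbitP; exists g.
(* The conjugating element [g] is corrected by [m] in [N] so as to fix [x]; [m] normalises [T'], so
   [T] is still sent to [T']. *)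
have [m Nm mgx] : exists2 m, m \in N & m (g x) = x.
  have: x \in orbit 'P N (g x) by rewrite (atransP N_trans) ?orbit_refl.
  by case/orbitP=> m; exists m.
have [g' [Gg' g'x eqT'g]] : exists g', [/\ g' \in G, g' x = x & T' :=: T :^ g'].
  exists (g * m); rewrite groupM ?(subsetP sNG m Nm) // permM conjsgM -eqT'.
  by rewrite (normP (subsetP nT'N m Nm)).
have xg'V u : e x u -> e x (g'^-1 u).
  by rewrite -(graph_autE x (g'^-1 u) Gg') g'x permKV.
have transR u : e x u -> exists2 r, r \in R & r y = u.
  case/component_orbit_nbr=> T1 [mnT1 [r /stabP[T1r rx] <-]].
  apply: orbC sX _ _ => //; apply/stabP.
  by rewrite (subsetP (normal_sub (min_normal_normal mnT1))).
(* The element [r] built here moves [g'^-1 y] to [g'^-1 (n y)], so [r ^ g'] moves [y] to [n y]. *)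
have [r1 Rr1 r1y] := transR _ (xg'V y xy).
have [r2 Rr2 r2y] := transR _ (xg'V _ (nbrX n Xn)).
pose r := r1^-1 * r2; have Rr : r \in R by rewrite groupM ?groupV.
have [Tr Xr] := setIP Rr; have [Nr rx] := stabP _ _ _ Xr.
exists (r ^ g').
  have Xrg := stab_conj Gg' Xr; rewrite g'x in Xrg; rewrite inE Xrg /=.
  by rewrite (subsetP (min_normal_commute mnT mnT' neqT)) // eqT'g memJ_conjg.
by rewrite conjgE !permM -r1y permK r2y permKV.
Qed.

End Edge.

(** * Global consequences of connectivity *)

Section Connected.

Hypothesis e_conn : forall x y, connect e x y.

Lemma connected_closed (P : V -> Prop) x :
  P x -> (forall u v, e u v -> P u -> P v) -> forall z, P z.
Proof.
move=> Px clP z; case/connectP: (e_conn x z) => p path_p ->.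
elim: p x Px path_p => [|u p IHp] //= x Px /andP[xu path_p].
exact: IHp (clP x u xu Px) path_p.
Qed.

(** If N_u moved a neighbour of [u], it would be transitive on all of them, which is impossible as
    it fixes [v]. Conjugation by [G] spreads this over the orbit of [u]. *)
Lemma stab_fix_nbrs u v : e u v -> 'C_N[u | 'P] \subset 'C[v | 'P] ->
  forall w z, w \in orbit 'P G u -> e w z -> 'C_N[w | 'P] \subset 'C[z | 'P].
Proof.
move=> uv /subsetP fix_C; have fix_v n : n \in 'C_N[u | 'P] -> n v = v.
  by move/fix_C/astab1P.
have fixN z n : e u z -> n \in 'C_N[u | 'P] -> n z = z.
  move=> uz Cn; apply/eqP; apply: wlog_neg => nz.
  have [m Cm mz] := stab_trans Cn nz uz uz uv.
  have eq_zv : z = v by apply: (@perm_inj _ m); rewrite mz fix_v.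
  by rewrite eq_zv fix_v.
move=> w z /orbitP[g Gg <-] /= wz; apply/subsetP=> n Cn; apply/astab1P.
have ugz : e u (g^-1 z) by rewrite -(graph_autE u (g^-1 z) Gg) permKV.
have := stab_conj (groupVr Gg) Cn; rewrite /= permK => /(fixN _ _ ugz).
by rewrite conjgE invgK !permM permKV => /(can_inj (permKV g)).
Qed.

(* If [N_x] fixed [y], then [N_x] would fix all neighbours of [x], while [N_y]
   moves those of [y], [N] being faithful.  As [N] is transitive on the orbit
   of [y], this leaves [y] as the only neighbour of [x], so the graph is a
   star with centre [y]. *)
Lemma stab_moves_nbr x y : e x y -> y \notin orbit 'P G x ->
    (forall z, (z \in orbit 'P G x) || (z \in orbit 'P G y)) ->
    [transitive N, on orbit 'P G y | 'P] -> 'C_N[x | 'P] != 1 ->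
  ~~ (N \subset 'C[y | 'P]) -> ~~ ('C_N[x | 'P] \subset 'C[y | 'P]).
Proof.
move=> xy nOy orbs trN ntCx; apply: contra => fix_y.
have [sNG nNG] := andP nsNG; have yx : e y x by rewrite e_sym.
(* Otherwise every vertex stabiliser in [N] fixes all neighbours, and by connectivity an element of
   N_x fixes the whole graph. *)
have [n0 Cn0 n0x] : exists2 n, n \in 'C_N[y | 'P] & n x != x.
  have [/exists_inP[n] | /exists_inPn no] :=
    boolP [exists n in 'C_N[y | 'P], n x != x]; first by exists n.
  have fix_x : 'C_N[y | 'P] \subset 'C[x | 'P].
    apply/subsetP=> n Cn; apply/astab1P/eqP.
    by have := no n Cn; rewrite negbK.
  have fixN u v : e u v -> 'C_N[u | 'P] \subset 'C[v | 'P].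
    case/orP: (orbs u) => Ou uv; first exact: (stab_fix_nbrs xy fix_y Ou uv).
    exact: (stab_fix_nbrs yx fix_x Ou uv).
  case/negP: ntCx; rewrite -subG1; apply/subsetP=> n Cn.
  rewrite inE; apply/eqP/permP=> z; rewrite perm1; move: z.
  have [Nn nx] := stabP _ _ _ Cn.
  apply: (connected_closed nx) => u v uv nu.
  have /(subsetP (fixN u v uv))/astab1P // : n \in 'C_N[u | 'P] by apply/stabP.
have not_orb g h : g \in G -> h \in G -> g x <> h y.
  move=> Gg Gh gx; case/negP: nOy; apply/orbitP; exists (g * h^-1).
    by rewrite groupM ?groupV.
  by rewrite /= apermE permM gx permK.
have nbr_x z : e x z -> z = y.
  move=> xz; case/orP: (orbs z) => /orbitP[].
    (* Edges within an orbit are not excluded a priori. If [z] is in the orbit of [x], the 2-arcs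
       [(x, y, n0 x)] and [(x, z, g y)] put [y] in that orbit too. *)
    move=> g Gg; rewrite /= apermE => gx.
    have ygx : e y (n0 x) by have [Nn0 <-] := stabP _ _ _ Cn0; rewrite graph_autE // (subsetP sNG).
    have zgy : e z (g y) by rewrite -gx graph_autE.
    have xgy : x != g y by apply/eqP=> eq_x; apply: (not_orb 1 g); rewrite ?perm1.
    have xn0x : x != n0 x by rewrite eq_sym.
    have [h [Gh _ hy _]] := two_arc_trans xy ygx xn0x xz zgy xgy.
    by case: (not_orb g h Gg Gh); rewrite gx.
  move=> g Gg; rewrite /= apermE => gy.
  (* Here [n] takes [y] to [z], and some [m] in N_z brings [n x] back to [x]. Then [n * m] lies in
     N_x, so it fixes [y], yet it sends [y] to [z]. *)
  have [n Nn ny] : exists2 n, n \in N & n y = z.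
    have: z \in orbit 'P N y.
      by rewrite (atransP trN) ?orbit_refl //; apply/orbitP; exists g.
    by case/orbitP=> n; exists n.
  have Gn := subsetP sNG n Nn.
  have Cn0n := stab_conj Gn Cn0; rewrite ny in Cn0n.
  have n0nx : (n0 ^ n) (n x) != n x.
    by rewrite conjgE !permM permK (inj_eq perm_inj).
  have znx : e z (n x) by rewrite -ny graph_autE.
  have [m Cm mnx] := stab_trans Cn0n n0nx znx znx (etrans (e_sym z x) xz).
  have [Nm mz] := stabP _ _ _ Cm.
  have Cnm : n * m \in 'C_N[x | 'P] by apply/stabP; rewrite groupM // permM.
  have /astab1P := subsetP fix_y _ Cnm.
  by rewrite /= apermE permM ny mz.
have nbr_y z : e y z -> exists2 m, m \in 'C_N[y | 'P] & m x = z.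
  by move=> yz; exact: (stab_trans Cn0 n0x yx yx yz).
have star z : z = y \/ e y z.
  move: z; apply: connected_closed (or_introl (erefl y)) _ => u v uv [eq_u | yu].
    by right; rewrite -eq_u.
  have [m Cm mx] := nbr_y u yu; have [Nm my] := stabP _ _ _ Cm; left.
  have xmv : e x (m^-1 v).
    by rewrite -(graph_autE x _ (subsetP sNG m Nm)) mx permKV.
  by rewrite -[v](permKV m) (nbr_x _ xmv).
(* Every neighbour of [y] has the form [m x], so [n y] cannot be one. *)
apply/subsetP=> n Nn; apply/astab1P; have [// | /nbr_y[m Cm mx]] := star (n y).
have [Nm _] := stabP _ _ _ Cm.
by case: (not_orb m n (subsetP sNG m Nm) (subsetP sNG n Nn)).
Qed.

(** N_x and N_y are transitive on the neighbours of [x] and [y], so the [L]-orbits of [x] and [y]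
    cover the connected graph. For [n] in [N], some element of [L] thus agrees with [n] at [x], and
    they differ by an element of N_x. *)
Lemma edge_stab_gen x y (L : {group {perm V}}) :
    e x y -> y \notin orbit 'P G x ->
    ~~ ('C_N[x | 'P] \subset 'C[y | 'P]) -> ~~ ('C_N[y | 'P] \subset 'C[x | 'P]) ->
    L \subset N -> 'C_N[x | 'P] \subset L -> 'C_N[y | 'P] \subset L ->
  N \subset L.
Proof.
move=> xy nOy moves_y moves_x sLN sxL syL; have [sNG nNG] := andP nsNG.
have yx : e y x by rewrite e_sym.
have step u v : e u v -> ~~ ('C_N[u | 'P] \subset 'C[v | 'P]) ->
    'C_N[u | 'P] \subset L ->
  forall w z, w \in orbit 'P L u -> e w z -> z \in orbit 'P L v.
- move=> uv /subsetPn[n Cn nv] suL w z /orbitP[l Ll <-] /= wz.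
  have nv' : n v != v by apply: contra nv => /eqP nv; apply/astab1P.
  have Gl : l \in G by rewrite (subsetP sNG) // (subsetP sLN).
  have uz : e u (l^-1 z) by rewrite -(graph_autE u _ Gl) permKV.
  have [m Cm mv] := stab_trans Cn nv' uv uv uz.
  apply/orbitP; exists (m * l); first by rewrite groupM // (subsetP suL).
  by rewrite /= apermE permM mv permKV.
have orbL : forall z, z \in orbit 'P L x \/ z \in orbit 'P L y.
  apply: connected_closed (or_introl (orbit_refl _ _ x)) _ => u v uv [Ou | Ou].
    by right; exact: (step x y xy moves_y sxL _ _ Ou uv).
  by left; exact: (step y x yx moves_x syL _ _ Ou uv).
apply/subsetP=> n Nn; case: (orbL (n x)) => /orbitP[l Ll]; rewrite /= apermE => lx.
  rewrite -(mulgKV l n) groupM // (subsetP sxL) //; apply/stabP.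
  by rewrite groupM ?groupV ?(subsetP sLN l) // permM -lx permK.
case/negP: nOy; apply/orbitP; exists (n * l^-1).
  by rewrite (subsetP sNG) // groupM ?groupV ?(subsetP sLN l).
by rewrite /= apermE permM -lx permK.
Qed.

End Connected.

End LocalAction.

(** * Comparison of the type PA structures on the two orbits *)

Theorem corollary2p2 (V : finType) (e : rel V) (G : {group {perm V}})
    (e_sym : symmetric e) (e_irr : irreflexive e)
    (e_conn : forall x y : V, connect e x y)
    (G_aut : G \subset graph_aut e)
    (G_2arc : locally_arc_transitive e G 2)
    (G_orbits : #|orbit 'P G @: [set: V]| = 2)
    (G_PA : forall S : {set V}, S \in orbit 'P G @: [set: V] ->
              quasiprimitive_PA 'P G S) :
  forall S : {set V}, S \in orbit 'P G @: [set: V] ->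
    ~~ [primitive G, on S | 'P].
Proof.
move=> _ /imsetP[x0 _ ->]; apply/negP=> primG.
have inO x : orbit 'P G x \in orbit 'P G @: [set: V] by exact: imset_f.
(* By connectivity some edge leaves the orbit of [x0]. *)
have [x [y [Ox xy nOy]]] : exists x y, [/\ x \in orbit 'P G x0, e x y & y \notin orbit 'P G x0].
  have [/existsP[x /existsP[y /and3P[]]] | no] :=
    boolP [exists x, exists y, [&& x \in orbit 'P G x0, e x y & y \notin orbit 'P G x0]].
    by exists x, y.
  have all_x0 : forall z, z \in orbit 'P G x0.
    apply: connected_closed e_conn _ _ (orbit_refl _ _ x0) _ => u v uv Ou.
    apply: contraR no => nOv; apply/existsP; exists u; apply/existsP; exists v.
    by rewrite Ou uv.
  have: #|[set orbit 'P G x0]| < #|orbit 'P G @: [set: V]| by rewrite cards1 G_orbits.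
  rewrite ltnNge subset_leq_card //; apply/subsetP=> _ /imsetP[z _ ->].
  by rewrite inE (orbit_eqP (all_x0 z)).
rewrite -(orbit_eqP Ox) in primG nOy.
have orbs z : (z \in orbit 'P G x) || (z \in orbit 'P G y).
  have: orbit 'P G z \in orbit 'P G @: [set: V] by [].
  suffices <- : [set orbit 'P G x; orbit 'P G y] = orbit 'P G @: [set: V].
    by rewrite !inE => /orP[] /eqP <-; rewrite orbit_refl ?orbT.
  apply/eqP; rewrite eqEcard G_orbits cards2 subUset !sub1set !inO /=.
  by rewrite (contraNneq _ nOy) // => ->; apply: orbit_refl.
have [N [[mnN uniqN ZN1 [T1 [T2 [mnT1 mnT2 neqT]]]]
         [trNx ntx [T0 mnT0 notx] genx]]] := PA_components (G_PA _ (inO x)).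
have [N' [[mnN' _ _ _] [trNy nty [T mnT noty] _]]] := PA_components (G_PA _ (inO y)).
(* Uniqueness gives both orbits the same [N], hence the same components. *)
have {mnN' uniqN} eqN := uniqN _ mnN'; subst N'.
have nsNG := min_normal_normal mnN; have sNG := normal_sub nsNG.
have moved U z : ~~ (N \subset 'C_N(U) * 'C_N[z | 'P]) -> ~~ (N \subset 'C[z | 'P]).
  by apply: contra => sNC; rewrite (setIidPl sNC) mulG_subr.
have yx : e y x by rewrite e_sym.
have nOx : x \notin orbit 'P G y by rewrite orbit_sym.
have moves_y : ~~ ('C_N[x | 'P] \subset 'C[y | 'P]).
  apply: (@stab_moves_nbr _ e G) => //; first exact: ntx (orbit_refl _ _ _).
  exact: moved (noty y (orbit_refl _ _ _)).
have moves_x : ~~ ('C_N[y | 'P] \subset 'C[x | 'P]).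
  apply: (@stab_moves_nbr _ e G) => //; last 2 first.
  - exact: nty (orbit_refl _ _ _).
  - exact: moved (notx x (orbit_refl _ _ _)).
  by move=> z; rewrite orbC.
have [T' mnT' neqT'] : exists2 T' : {group {perm V}}, min_normal_sub T' N & T' :!=: T.
  have [eqT1 | ] := eqVneq (T1 : {set _}) T; last by exists T1.
  exists T2 => //; apply: contra_notN neqT => /eqP eqT2.
  by apply: val_inj; rewrite /= eqT1.
(* Primitivity on the orbit of [x] is applied to [T], the component supplied by the orbit of [y]. *)
have Nx := stab_sub_cent_prod e_sym G_aut G_2arc nsNG xy moves_y mnN ZN1 trNx
  (genx primG x (orbit_refl _ _ _)) mnT mnT' neqT'.
case/negP: (noty y (orbit_refl _ _ _)).
(* The product of C_N(T) and N_y is a group containing N_x and N_y, hence [N], against [noty]. *)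
have nC : 'C_N[y | 'P] \subset 'N('C_N(T)).
  apply: subset_trans (subsetIl _ _) (normsI (normG _) (norms_cent _)).
  exact: normal_norm (min_normal_normal mnT).
rewrite -norm_joinEr // in Nx *.
apply: (edge_stab_gen e_sym G_aut G_2arc nsNG e_conn xy nOy moves_y moves_x) => //.
  by rewrite join_subG !subsetIl.
exact: joing_subr.
Qed.
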